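(* Let $\mathfrak{g}_{2|4}^{2}$, $\mathfrak{g}_{2|4}^{3}(\lambda)$ ($\lambda\in\mathbb{C}$, $\lambda\neq0$) and $\mathfrak{g}_{2|4}^{5}$ be the complex Lie superalgebras of dimension $2|4$ with basis $\{e_1,e_2\mid e_3,e_4,e_5,e_6\}$ ($e_1,e_2$ even, $e_3,\dots,e_6$ odd) and nontrivial brackets \begin{align*} \mathfrak{g}_{2|4}^{2}:\ &[e_2,e_4]=e_4,\ [e_2,e_5]=e_3,\ [e_2,e_6]=-e_6,\ [e_5,e_5]=[e_4,e_6]=e_1;\\ \mathfrak{g}_{2|4}^{3}(\lambda):\ &[e_2,e_3]=e_3,\ [e_2,e_4]=\lambda e_4,\ [e_2,e_5]=-e_5,\ [e_2,e_6]=-\lambda e_6,\ [e_3,e_5]=e_1,\ [e_4,e_6]=\lambda e_1;\\ \mathfrak{g}_{2|4}^{5}:\ &[e_2,e_3]=e_5,\ [e_2,e_4]=e_3,\ [e_2,e_5]=-e_6,\ [e_3,e_3]=-e_1,\ [e_4,e_5]=e_1. \end{align*} Then $\mathfrak{g}_{2|4}^{5}$ has jump metric deformations to $\mathfrak{g}_{2|4}^{2}$ and to $\mathfrak{g}_{2|4}^{3}(\sqrt{-1})$, and it has a smooth metric deformation to the family $\mathfrak{g}_{2|4}^{3}(\lambda)$ around $\lambda=\sqrt{-1}$.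
   Context: All Lie superalgebras are over $\mathbb{C}$. Brackets of basis elements that are not listed are zero or determined by $[y,x]=-(-1)^{|x||y|}[x,y]$. A metric Lie superalgebra is a Lie superalgebra together with an even, non-degenerate, supersymmetric bilinear form $B$ that is invariant: $B([x,y],z)=B(x,[y,z])$. A formal 1-parameter deformation of a Lie superalgebra $(\mathfrak g,[\ ,\ ])$ is a $\mathbb{C}[[t]]$-bilinear Lie superalgebra structure on $\mathfrak g[[t]]=\mathfrak g\otimes_{\mathbb C}\mathbb{C}[[t]]$ of the form $[\ ,\ ]_t=[\ ,\ ]+\sum_{i\ge1}t^i\phi_i$, each $\phi_i:\mathfrak g\times\mathfrak g\to\mathfrak g$ being an even super-skew-symmetric bilinear map. A metric deformation is a formal 1-parameter deformation that defines a metric Lie superalgebra, i.e. $(\mathfrak g[[t]],[\ ,\ ]_t)$ admits an even, supersymmetric, invariant $\mathbb{C}[[t]]$-bilinear form that is non-degenerate over $\mathbb{C}[[t]]$ (induces an isomorphism with the dual module). A deformation is a jump deformation to $\mathfrak h$ if for every non-zero value of $t$ near the origin it gives an algebra isomorphic to the same Lie superalgebra $\mathfrak h$, which is not isomorphic to $\mathfrak g$. It is smooth if for different non-zero values of $t$ near the origin it defines non-isomorphic algebras (coincidences caused by symmetry being allowed). It is a smooth deformation to a family $\mathfrak h(\lambda)$ around $\lambda_0$ if it is smooth and for non-zero $t$ near the origin it is isomorphic to $\mathfrak h(\lambda(t))$ with $\lambda(t)\to\lambda_0$ as $t\to0$. *)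

(* Defs.v *)
From HB Require Import structures.
From mathcomp Require Import all_boot all_order all_algebra.
From mathcomp Require Import all_classical all_reals all_analysis.
From mathcomp Require Export complex.

Set Implicit Arguments.
Unset Strict Implicit.
Unset Printing Implicit Defensive.

Import Order.TTheory GRing.Theory Num.Theory.
Import numFieldNormedType.Exports.

Local Open Scope classical_set_scope.
Local Open Scope ring_scope.

(** * The ring K[[t]] of formal power series *)

Record fps (K : comNzRingType) := FPS { fpscoef : nat -> K }.

Section FpsRing.
Variable K : comNzRingType.
Implicit Types f g h : fps K.

HB.instance Definition _ := gen_eqMixin (fps K).
HB.instance Definition _ := gen_choiceMixin (fps K).

Lemma fpsP f g : fpscoef f =1 fpscoef g -> f = g.
Proof. by case: f g => [f] [g] /= /funext ->. Qed.

Definition fps_zero : fps K := FPS (fun=> 0).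
Definition fps_one : fps K := FPS (fun n => (n == 0%N)%:R).
Definition fps_opp f : fps K := FPS (fun n => - fpscoef f n).
Definition fps_add f g : fps K := FPS (fun n => fpscoef f n + fpscoef g n).
Definition fps_mul f g : fps K :=
  FPS (fun n => \sum_(i < n.+1) fpscoef f i * fpscoef g (n - i)%N).

Lemma fps_addA : associative fps_add.
Proof. by move=> f g h; apply: fpsP => n /=; rewrite addrA. Qed.
Lemma fps_addC : commutative fps_add.
Proof. by move=> f g; apply: fpsP => n /=; rewrite addrC. Qed.
Lemma fps_add0 : left_id fps_zero fps_add.
Proof. by move=> f; apply: fpsP => n /=; rewrite add0r. Qed.
Lemma fps_addN : left_inverse fps_zero fps_opp fps_add.
Proof. by move=> f; apply: fpsP => n /=; rewrite addNr. Qed.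

HB.instance Definition _ :=
  GRing.isZmodule.Build (fps K) fps_addA fps_addC fps_add0 fps_addN.

Lemma fps_mulE f g n :
  fpscoef (fps_mul f g) n =
  ((\poly_(i < n.+1) fpscoef f i) * (\poly_(i < n.+1) fpscoef g i))`_n.
Proof.
rewrite coefM /=; apply: eq_bigr => i _.
by rewrite !coef_poly ltn_ord ltnS leq_subr.
Qed.

Lemma fps_mulC : commutative fps_mul.
Proof. by move=> f g; apply: fpsP => n; rewrite !fps_mulE mulrC. Qed.

Lemma fps_mul_poly f g (p q : {poly K}) n :
  (forall i, (i <= n)%N -> p`_i = fpscoef f i) ->
  (forall i, (i <= n)%N -> q`_i = fpscoef g i) ->
  forall i, (i <= n)%N -> (p * q)`_i = fpscoef (fps_mul f g) i.
Proof.
move=> pf qg i lein; rewrite coefM /=; apply: eq_bigr => j _.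
rewrite pf ?qg //; first by apply: leq_trans lein; rewrite leq_subr.
by apply: leq_trans lein; rewrite -ltnS.
Qed.

Lemma fps_mulA : associative fps_mul.
Proof.
move=> f g h; apply: fpsP => n.
pose P k := \poly_(i < n.+1) fpscoef k i : {poly K}.
have PE k i : (i <= n)%N -> (P k)`_i = fpscoef k i.
  by move=> lein; rewrite coef_poly ltnS lein.
have PM k l := fps_mul_poly (PE k) (PE l).
rewrite -(fps_mul_poly (PE f) (PM g h) (leqnn n)).
by rewrite -(fps_mul_poly (PM f g) (PE h) (leqnn n)) mulrA.
Qed.

Lemma fps_mul1 : left_id fps_one fps_mul.
Proof.
move=> f; apply: fpsP => n /=; rewrite big_ord_recl /= mul1r subn0.
by rewrite big1 ?addr0 // => i _; rewrite mul0r.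
Qed.

Lemma fps_mulDl : left_distributive fps_mul fps_add.
Proof.
move=> f g h; apply: fpsP => n /=; rewrite -big_split /=.
by apply: eq_bigr => i _; rewrite mulrDl.
Qed.

Lemma fps_one_neq0 : fps_one != 0 :> fps K.
Proof.
apply/eqP => /(congr1 (fun f => fpscoef f 0)) /= /eqP.
by rewrite oner_eq0.
Qed.

HB.instance Definition _ := GRing.Zmodule_isComNzRing.Build (fps K)
  fps_mulA fps_mulC fps_mul1 fps_mulDl fps_one_neq0.

End FpsRing.

(** * Superalgebra structures on the free module R^(m|n)

  The first m coordinates of ['rV[R]_(m + n)] are even, the last n are odd.
  A bilinear bracket is given by its values on the canonical basis.  All the
  notions are stated over a commutative ring R, to be used for both R = K and
  R = K[[t]]. *)

Section Superalgebra.
Variables (R : comNzRingType) (m n : nat).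

Definition structure_constants := 'I_(m + n) -> 'I_(m + n) -> 'rV[R]_(m + n).

Implicit Types (c d : structure_constants) (x y z : 'rV[R]_(m + n)).

Definition parity (i : 'I_(m + n)) : bool := (m <= i)%N.

Definition bracket c x y : 'rV[R]_(m + n) :=
  \sum_i \sum_j (x 0 i * y 0 j) *: c i j.

Definition homogeneous (p : bool) x : Prop :=
  forall i, parity i != p -> x 0 i = 0.

Definition koszul (p q : bool) : R := (-1) ^+ (p && q).

Definition even_bracket c : Prop :=
  forall p q x y, homogeneous p x -> homogeneous q y ->
    homogeneous (p (+) q) (bracket c x y).

Definition super_skew c : Prop :=
  forall p q x y, homogeneous p x -> homogeneous q y ->
    bracket c y x = - koszul p q *: bracket c x y.

Definition super_jacobi c : Prop :=
  forall p q x y z, homogeneous p x -> homogeneous q y ->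
    bracket c x (bracket c y z) =
    bracket c (bracket c x y) z + koszul p q *: bracket c y (bracket c x z).

Definition lie_superalgebra c : Prop :=
  [/\ even_bracket c, super_skew c & super_jacobi c].

Definition form (B : 'M[R]_(m + n)) x y : R := (x *m B *m y^T) 0 0.

Definition even_form B : Prop :=
  forall p q x y, homogeneous p x -> homogeneous q y -> p != q ->
    form B x y = 0.

Definition supersymmetric B : Prop :=
  forall p q x y, homogeneous p x -> homogeneous q y ->
    form B y x = koszul p q * form B x y.

Definition invariant_form c B : Prop :=
  forall x y z, form B (bracket c x y) z = form B x (bracket c y z).

(* x |-> B(x, -) is a bijection onto the dual module *)
Definition nondegenerate B : Prop :=
  forall f : {scalar 'rV[R]_(m + n)}, exists! x, forall y, form B x y = f y.

Definition metric_lie_superalgebra c : Prop :=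
  lie_superalgebra c /\
  exists B, [/\ even_form B, supersymmetric B, invariant_form c B
              & nondegenerate B].

Definition lie_isomorphic c d : Prop :=
  exists f : {linear 'rV[R]_(m + n) -> 'rV[R]_(m + n)},
    [/\ bijective f,
        forall p x, homogeneous p x -> homogeneous p (f x)
      & forall x y, f (bracket c x y) = bracket d (f x) (f y)].

Definition entry (a b k : nat) (u : R) := (a, b, k, u).

(* [entry a b k u] stands for a term u e_k of [e_a, e_b], basis vectors being
   numbered from 1; [e_b, e_a] is deduced by super-skew-symmetry, so that for
   a != b only one of the two brackets may be listed. *)
Definition of_table (s : seq (nat * nat * nat * R)) : structure_constants :=
  fun i j => \row_k \sum_(e <- s)
    let: (a, b, k', u) := e in
    if k' == k.+1 :> nat then
      if (a == i.+1 :> nat) && (b == j.+1 :> nat) then u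
      else if (a == j.+1 :> nat) && (b == i.+1 :> nat) then
        - koszul (parity j) (parity i) * u
      else 0
    else 0.

End Superalgebra.

Arguments of_table {R} m n s.

(** * Deformations *)

Section Deformation.
Variables (K : numFieldType) (m n : nat).
Local Notation bracketsK := (structure_constants K m n).

Implicit Types (g h : bracketsK) (phi : nat -> bracketsK).

(* the K[[t]]-bilinear bracket \sum_i t^i phi_i *)
Definition formal_bracket phi : structure_constants (fps K) m n :=
  fun i j => \row_k FPS (fun r => phi r i j 0 k).

Definition formal_deformation g phi : Prop :=
  [/\ phi 0%N =2 g,
      forall i, (0 < i)%N -> even_bracket (phi i) /\ super_skew (phi i)
    & lie_superalgebra (formal_bracket phi)].

Definition metric_deformation g phi : Prop :=
  formal_deformation g phi /\ metric_lie_superalgebra (formal_bracket phi).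

(* The bracket g is the value at t = a of the deformation phi: the power
   series of the structure constants converge at a, with sum g. *)
Definition specializes phi (a : K) g : Prop :=
  forall i j k, series (fun r => phi r i j 0 k * a ^+ r) @ \oo --> g i j 0 k.

Definition jump_deformation g phi h : Prop :=
  [/\ formal_deformation g phi, ~ lie_isomorphic g h
    & \forall a \near 0^', exists2 ga, specializes phi a ga
                                     & lie_isomorphic ga h].

(* For small non-zero parameters, the deformation takes isomorphic values at
   distinct a and b only if the coincidence a ~ b is allowed. *)
Definition smooth_up_to (allowed : K -> K -> Prop) g phi : Prop :=
  formal_deformation g phi /\
  \forall a \near 0^' & b \near 0^', a != b ->
    forall ga gb, specializes phi a ga -> specializes phi b gb ->
      lie_isomorphic ga gb -> allowed a b.

(* symmetries of a family h(l), l in L *)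
Definition family_symmetry (L : set K) (h : K -> bracketsK) (sigma : K -> K)
    : Prop :=
  [/\ set_bij L L sigma, {within L, continuous sigma}
    & forall l, L l -> lie_isomorphic (h l) (h (sigma l))].

(* The values of the deformation at two distinct small parameters a and b may
   be isomorphic only when l(a) and l(b) are distinct and exchanged by one of
   finitely many symmetries of the family; in particular l is injective on a
   punctured neighborhood of 0. *)
Definition smooth_deformation_around g phi (L : set K) (h : K -> bracketsK)
    (l0 : K) : Prop :=
  exists l : K -> K, exists Gamma : set (K -> K),
    [/\ finite_set Gamma /\ Gamma `<=` family_symmetry L h,
        smooth_up_to (fun a b => l a != l b /\
          exists2 sigma, Gamma sigma & l b = sigma (l a)) g phi,
        \forall a \near 0^', L (l a) /\
          exists2 ga, specializes phi a ga & lie_isomorphic ga (h (l a))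
      & l a @[a --> 0^'] --> l0].

End Deformation.

(** * The Lie superalgebras of dimension 2|4 *)

Section Algebras.
Variable K : comNzRingType.

Definition g2_24 : structure_constants K 2 4 := of_table 2 4
  [:: entry 2 4 4 1; entry 2 5 3 1; entry 2 6 6 (-1);
      entry 5 5 1 1; entry 4 6 1 1].

Definition g3_24 (l : K) : structure_constants K 2 4 := of_table 2 4
  [:: entry 2 3 3 1; entry 2 4 4 l; entry 2 5 5 (-1); entry 2 6 6 (- l);
      entry 3 5 1 1; entry 4 6 1 l].

Definition g5_24 : structure_constants K 2 4 := of_table 2 4
  [:: entry 2 3 5 1; entry 2 4 3 1; entry 2 5 6 (-1);
      entry 3 3 1 (-1); entry 4 5 1 1].

End Algebras.

(* Main.v *)
(* An even element e_2 acting on the odd part V by a symplectic endomorphism D,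
   together with the brackets [v, w] = omega (D v, w) e_1, defines a metric Lie
   superalgebra over any commutative ring.  All the algebras at hand are of this
   form: D is a nilpotent Jordan block for g^5, has eigenvalues 1, -1, 0, 0 (with
   a Jordan block at 0) for g^2, and 1, l, -1, -l for g^3(l).  The family with D
   regular of characteristic polynomial X^4 - u X^2 - v deforms g^5; the choices
   (u, v) = (t^2, 0) and (u, v) = (t^2 (1 + l^2), - t^4 l^2), with l = i or
   l = i + t, give the three deformations.  Isomorphic algebras have proportional
   spectra, which separates the algebras and shows that g^3(l) and g^3(m) are
   isomorphic only if m is one of l, -l, 1/l, -1/l. *)
From HB Require Import structures.
Require Import Defs.
From mathcomp Require Import all_boot all_order all_algebra.
From mathcomp Require Import all_classical all_reals all_analysis.
From mathcomp Require Import complex.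
From mathcomp Require Import ring.
Import Order.TTheory GRing.Theory Num.Theory.
Import numFieldNormedType.Exports.
Local Open Scope classical_set_scope.
Local Open Scope ring_scope.

Set Implicit Arguments.
Unset Strict Implicit.
Unset Printing Implicit Defensive.

(** * Coordinates, and brackets given by tables *)

Section Coordinates.
Variables (R : comNzRingType) (m n : nat).
Implicit Types (x y : 'rV[R]_(m + n)) (s : seq (nat * nat * nat * R)).

(* Basis vectors are numbered from 1, as in [entry]; the value is 0 out of
   range. *)
Definition crd x (a : nat) : R := \sum_(i < m + n | i.+1 == a) x 0 i.

Lemma crdS x (i : 'I_(m + n)) : crd x i.+1 = x 0 i.
Proof. by rewrite /crd (big_pred1 i) // => j; rewrite eqSS. Qed.

Lemma eq_crd x y : (forall a, (a < m + n)%N -> crd x a.+1 = crd y a.+1) <-> x = y.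
Proof.
split=> [xy|-> //]; apply/rowP => i.
by rewrite -[x _ _]crdS -[y _ _]crdS xy.
Qed.

Lemma crdZ a x k : crd (a *: x) k = a * crd x k.
Proof. by rewrite /crd mulr_sumr; apply: eq_bigr => i _; rewrite mxE. Qed.

Lemma crdD x y k : crd (x + y) k = crd x k + crd y k.
Proof. by rewrite /crd -big_split; apply: eq_bigr => i _; rewrite mxE. Qed.

Lemma crd0 k : crd 0 k = 0.
Proof. by rewrite -(scale0r 0) crdZ mul0r. Qed.

Lemma homogeneousP p x :
  homogeneous p x <->
  (forall a, (a < m + n)%N -> (m < a.+1)%N != p -> crd x a.+1 = 0).
Proof.
split=> [hx a an ap|hx i ip].
  by rewrite -[a]/(nat_of_ord (Ordinal an)) crdS; exact: hx.
by rewrite -crdS hx.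
Qed.

Lemma bracketE (c : structure_constants R m n) x y k :
  bracket c x y 0 k = \sum_i \sum_j x 0 i * y 0 j * c i j 0 k.
Proof.
rewrite /bracket summxE; apply: eq_bigr => i _.
by rewrite summxE; apply: eq_bigr => j _; rewrite mxE.
Qed.

(** Turns brackets into polynomials in the coordinates, so that later identities are left to [ring].
    An entry with a = b counts once: the first test of [of_table] then hides its mirror image. *)
Lemma crd_bracket s x y k : (k < m + n)%N ->
  crd (bracket (of_table m n s) x y) k.+1 =
  \sum_(e <- s) let: (a, b, k', u) := e in
    if k' == k.+1 then
      u * (crd x a * crd y b -
           if a == b then 0
           else (-1) ^+ ((m < a)%N && (m < b)%N) * (crd x b * crd y a))
    else 0.
Proof.
move=> kn; rewrite -[k]/(nat_of_ord (Ordinal kn)) crdS /=.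
rewrite bracketE.
transitivity (\sum_i \sum_(e <- s) \sum_j x 0 i * y 0 j *
    of_table m n [:: e] i j 0 (Ordinal kn)).
  apply: eq_bigr => i _; rewrite exchange_big; apply: eq_bigr => j _ /=.
  by rewrite mxE mulr_sumr; apply: eq_bigr => e _; rewrite mxE big_seq1.
rewrite exchange_big; apply: eq_bigr => -[[[a b] k'] u] _ /=.
under eq_bigr => i _ do under eq_bigr => j _ do rewrite mxE big_seq1 /=.
case: eqP => _; last by rewrite big1 // => i _; rewrite big1 // => j _; rewrite mulr0.
pose T (i j : 'I_(m + n)) : R := (a == i.+1)%:R * (b == j.+1)%:R * u.
pose T' (i j : 'I_(m + n)) : R := ((a != b) && (a == j.+1))%:R * (b == i.+1)%:R *
  ((-1) ^+ ((m < a)%N && (m < b)%N) * u).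
transitivity (\sum_i \sum_j (x 0 i * y 0 j) * (T i j - T' i j)).
  apply: eq_bigr => i _; apply: eq_bigr => j _; congr (_ * _); rewrite /T /T'.
  have [->|_] := eqVneq a j.+1; have [->|_] := eqVneq b i.+1.
  - rewrite [i.+1 == _]eq_sym; have [_|ji] := eqVneq j.+1 i.+1 => /=; first by ring.
    by rewrite /koszul /parity; ring.
  - by case: eqP; case: eqP => _ _ /=; ring.
  - by rewrite andbF; case: eqP; case: eqP => _ _ /=; ring.
  - by rewrite andbF; case: eqP; case: eqP => _ _ /=; ring.
have crdE z c : crd z c = \sum_i z 0 i * (c == i.+1)%:R.
  rewrite /crd big_mkcond; apply: eq_bigr => i _; rewrite eq_sym.
  by case: eqP; rewrite ?mulr1 ?mulr0.
have -> : crd x a * crd y b = \sum_i \sum_j x 0 i * y 0 j * ((a == i.+1)%:R * (b == j.+1)%:R).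
  rewrite !crdE big_distrlr; apply: eq_bigr => i _; apply: eq_bigr => j _ /=.
  by rewrite mulrACA.
have -> : crd x b * crd y a = \sum_i \sum_j x 0 i * y 0 j * ((a == j.+1)%:R * (b == i.+1)%:R).
  rewrite !crdE big_distrlr; apply: eq_bigr => i _; apply: eq_bigr => j _ /=.
  by rewrite mulrACA [_%:R * _%:R]mulrC.
rewrite mulrBr mulr_sumr; under [X in _ = X - _]eq_bigr => i _ do rewrite mulr_sumr.
have -> : u * (if a == b then 0 else (-1) ^+ ((m < a)%N && (m < b)%N) *
  (\sum_i \sum_j x 0 i * y 0 j * ((a == j.+1)%:R * (b == i.+1)%:R))) =
  \sum_i \sum_j (x 0 i * y 0 j) * T' i j.
  rewrite /T'; case: eqP => _ /=.
    rewrite mulr0 big1 // => i _; rewrite big1 // => j _.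
    by rewrite !mul0r mulr0.
  rewrite mulrA mulr_sumr; apply: eq_bigr => i _; rewrite mulr_sumr.
  by apply: eq_bigr => j _; ring.
rewrite -sumrB; apply: eq_bigr => i _; rewrite -sumrB; apply: eq_bigr => j _.
by rewrite /T; ring.
Qed.

Lemma crd_homogeneous p x a : homogeneous p x -> (m < a)%N != p -> crd x a = 0.
Proof.
move=> hx ap; case: a ap => [|a] ap; first by rewrite /crd big1.
have [an|an] := ltnP a (m + n); first by move/homogeneousP: hx => ->.
by rewrite /crd big1 // => i /eqP[ia]; move: (ltn_ord i); rewrite ia ltnNge an.
Qed.

(** Coordinates of the wrong parity vanish, so the sign read on the indices can be traded for the
    sign read on the degrees. *)
Lemma homogeneous_koszul p q x y a b : homogeneous p x -> homogeneous q y ->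
  (-1) ^+ ((m < a)%N && (m < b)%N) * (crd x a * crd y b) =
  koszul R p q * (crd x a * crd y b).
Proof.
move=> hx hy; have [<-|/(crd_homogeneous hx)->] := eqVneq (m < a)%N p; last by ring.
have [<- //|/(crd_homogeneous hy)->] := eqVneq (m < b)%N q; by ring.
Qed.

Lemma homogeneous_parity p q x y a b : homogeneous p x -> homogeneous q y ->
  (m < a)%N (+) (m < b)%N != p (+) q -> crd x a * crd y b = 0.
Proof.
move=> hx hy; have [<-|/(crd_homogeneous hx)->] := eqVneq (m < a)%N p; last by rewrite mul0r.
have [<-|/(crd_homogeneous hy)->] := eqVneq (m < b)%N q; last by rewrite mulr0.
by rewrite eqxx.
Qed.

Lemma koszulxx p q : koszul R p q * koszul R p q = 1.
Proof. by rewrite /koszul -expr2 sqrr_sign. Qed.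

(** Super-skew-symmetry makes [e_a, e_a] vanish for even e_a, hence the condition on diagonal
    entries. *)
Lemma of_table_super_skew s :
  all (fun e => let: (a, b, _, _) := e in (a == b) ==> (m < a)%N) s ->
  super_skew (of_table m n s).
Proof.
move=> /allP s_odd p q x y hx hy; apply/eq_crd => k kn.
rewrite crdZ !crd_bracket // mulr_sumr; apply: eq_big_seq => -[[[a b] k'] u] /s_odd ab_odd.
case: (k' == k.+1); last by rewrite mulr0.
move: ab_odd; have [<-|ab _] := eqVneq a b.
  move=> /= ma; have := homogeneous_koszul a a hx hy; rewrite ma /= expr1 => kE.
  by rewrite !subr0 mulNr [koszul _ _ _ * _]mulrCA -kE; ring.
rewrite [crd y a * _]mulrC [crd y b * _]mulrC.
have:= homogeneous_koszul b a hx hy; rewrite andbC => kE.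
rewrite (homogeneous_koszul a b hx hy) kE.
have kk := koszulxx p q.
by ring: kk.
Qed.

Lemma of_table_even s :
  all (fun e => let: (a, b, k, _) := e in
    (m < k)%N == (m < a)%N (+) (m < b)%N) s ->
  even_bracket (of_table m n s).
Proof.
move=> /allP s_ev p q x y hx hy; apply/homogeneousP => k kn kpq.
rewrite crd_bracket // big_seq big1 // => -[[[a b] k'] u] /s_ev /eqP kab.
case: eqP => // k'k; rewrite -k'k kab in kpq.
rewrite (homogeneous_parity hx hy) // (homogeneous_parity hx hy); last by rewrite addbC.
by case: ifP => _; ring.
Qed.
End Coordinates.

(** * Change of scalars in tables, and a criterion of non-degeneracy *)

Definition map_table (R S : Type) (f : R -> S) : seq (nat * nat * nat * R) -> _ :=
  map (fun e => let: (a, b, k, u) := e in (a, b, k, f u)).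

(** The Koszul signs are 1 or -1, which additive maps respect. Serves for coefficient extraction,
    for evaluation at a point and for the passage from polynomials to power series. *)
Lemma of_table_map (R S : comNzRingType) m n (f : {additive R -> S}) s i j k :
  of_table m n (map_table f s) i j 0 k = f (of_table m n s i j 0 k).
Proof.
rewrite !mxE raddf_sum big_map; apply: eq_bigr => -[[[a b] k'] u] _ /=.
case: ifP => _; last by rewrite raddf0.
case: ifP => _ //; case: ifP => _; last by rewrite raddf0.
by rewrite /koszul !mulNr (raddfN f) (raddfMsign f).
Qed.

Lemma mulmx_eq1 (R : pzRingType) n (M N : 'M[R]_n) :
  (forall x : 'rV_n, x *m M *m N = x) -> M *m N = 1%:M.
Proof. by move=> MN; apply/row_matrixP => i; rewrite rowE mulmxA MN rowE mulmx1. Qed.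

(** With v the row of values of f on the basis, f is y -> v y^T, so it is represented by the
    solution v B' of x B = v. *)
Lemma nondegenerate_mx (R : comNzRingType) m n (B B' : 'M[R]_(m + n)) :
  B *m B' = 1%:M -> Defs.nondegenerate B.
Proof.
move=> BB' f; have B'B := mulmx1C BB'.
pose v : 'rV[R]_(m + n) := \row_j f (delta_mx 0 j).
have fE y : f y = (v *m y^T) 0 0.
  rewrite {1}[y]row_sum_delta linear_sum mxE; apply: eq_bigr => j _ /=.
  by rewrite linearZ /= !mxE mulrC.
exists (v *m B'); split=> [y|x xf].
  by rewrite /Defs.form -(mulmxA v) B'B mulmx1 fE.
suff -> : v = x *m B by rewrite -mulmxA BB' mulmx1.
apply/rowP => j; rewrite mxE -xf /Defs.form trmx_delta -colE.
by rewrite !mxE.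
Qed.

(** * Isomorphism as an equivalence relation *)

Section Isomorphism.
Variables (R : comNzRingType) (m n : nat).
Implicit Types c d e : structure_constants R m n.

Lemma eq_lie_isomorphic c c' d : c =2 c' -> lie_isomorphic c d -> lie_isomorphic c' d.
Proof.
move=> cc' [f [bf pf mf]]; exists f; split=> // x y; rewrite -mf; congr (f _).
by rewrite /bracket; apply: eq_bigr => i _; apply: eq_bigr => j _; rewrite cc'.
Qed.

Lemma lie_isomorphic_mx c d (M N : 'M[R]_(m + n)) :
    (forall x : 'rV_(m + n), x *m M *m N = x) ->
    (forall p x, homogeneous p x -> homogeneous p (x *m M)) ->
    (forall x y, bracket c x y *m M = bracket d (x *m M) (y *m M)) ->
  lie_isomorphic c d.
Proof.
move=> MK pM mM; exists (mulmxr M); split=> //.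
have MN := mulmx_eq1 MK.
by exists (mulmxr N) => x /=; rewrite ?MK // -mulmxA (mulmx1C MN) mulmx1.
Qed.

(** The delicate point is that the inverse g preserves parity. For x of parity p, f sends the part
    of g x of the other parity to x - f (part of parity p), which is homogeneous of both parities,
    hence 0. *)
Lemma lie_isomorphic_sym c d : lie_isomorphic c d -> lie_isomorphic d c.
Proof.
case=> f [[g fK gK] pf mf].
have g_lin : linear g.
  by move=> a x y; apply: (can_inj fK); rewrite linearP !gK.
pose G : {linear 'rV[R]_(m + n) -> 'rV[R]_(m + n)} :=
  HB.pack g (GRing.isLinear.Build _ _ _ _ g g_lin).
exists G; split; first by exists f.
  move=> p x hx /=.
  pose part q (z : 'rV[R]_(m + n)) : 'rV[R]_(m + n) :=
    \row_i (if parity i == q then z 0 i else 0).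
  have part_hom q z : homogeneous q (part q z).
    by move=> i iq; rewrite mxE (negPf iq).
  have partD z : part p z + part (~~ p) z = z.
    by apply/rowP => i; rewrite !mxE; case: (parity i); case: (p); rewrite /= ?addr0 ?add0r.
  suff g0 : part (~~ p) (g x) = 0.
    by rewrite -[g x]partD g0 addr0.
  apply: (can_inj fK); rewrite raddf0.
  have fE : f (part (~~ p) (g x)) = x - f (part p (g x)).
    by rewrite -[X in X - _](gK x) -[X in f X - _]partD raddfD addrAC subrr add0r.
  apply/rowP => i; rewrite [RHS]mxE; have [ip|ip] := eqVneq (parity i) p.
    by apply: (pf _ _ (part_hom _ _)); rewrite ip; case: (p).
  by rewrite fE !mxE hx // (pf _ _ (part_hom _ _)) // subr0.
by move=> x y /=; apply: (can_inj fK); rewrite mf !gK.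
Qed.

Lemma lie_isomorphic_refl c : lie_isomorphic c c.
Proof. by apply: (@lie_isomorphic_mx c c 1%:M 1%:M) => *; rewrite ?mulmx1. Qed.

Lemma lie_isomorphic_trans c d e :
  lie_isomorphic c d -> lie_isomorphic d e -> lie_isomorphic c e.
Proof.
move=> [f [bf pf mf]] [g [bg pg mg]]; exists (g \o f); split.
- exact: bij_comp.
- by move=> p x hx; apply: pg; apply: pf.
- by move=> x y /=; rewrite mf mg.
Qed.
End Isomorphism.

(** * Coordinates and parity in dimension 2|4 *)

Section Dimension24.
Variable R : comNzRingType.
Implicit Types (x y : 'rV[R]_(2 + 4)).

Lemma eq_crd24 x y :
    @crd R 2 4 x 1 = @crd R 2 4 y 1 -> @crd R 2 4 x 2 = @crd R 2 4 y 2 ->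
    @crd R 2 4 x 3 = @crd R 2 4 y 3 -> @crd R 2 4 x 4 = @crd R 2 4 y 4 ->
    @crd R 2 4 x 5 = @crd R 2 4 y 5 -> @crd R 2 4 x 6 = @crd R 2 4 y 6 -> x = y.
Proof. by move=> *; apply/eq_crd => -[|[|[|[|[|[|//]]]]]]. Qed.

Lemma homogeneous24P p x : homogeneous p x <->
  if p then @crd R 2 4 x 1 = 0 /\ @crd R 2 4 x 2 = 0
  else [/\ @crd R 2 4 x 3 = 0, @crd R 2 4 x 4 = 0,
           @crd R 2 4 x 5 = 0 & @crd R 2 4 x 6 = 0].
Proof.
split; first by move=> h; case: p h => h; split; apply: crd_homogeneous h _.
by case: p => -[]; intros; apply/homogeneousP => -[|[|[|[|[|[|//]]]]]].
Qed.

End Dimension24.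

Ltac use_parity :=
  repeat match goal with
    | H : homogeneous ?p _ |- _ => move/homogeneous24P: H; case: p => /= -[]
    | |- @eq _ _ _ -> _ => let e := fresh in move=> e; rewrite ?e; clear e
    end.

(** * The two-parameter deformation of g^5 and its invariant form *)

Section Deformed.
Variable R : comNzRingType.
Implicit Types (x y z : 'rV[R]_(2 + 4)).

(* Missing entries are 0. *)
Definition rows_mx (rows : seq (seq R)) : 'M[R]_(2 + 4) :=
  \matrix_(i, j) (nth [::] rows i)`_j.

Lemma crd_rows_mx rows x k : (k < 6)%N ->
  crd (x *m rows_mx rows) k.+1 =
  @crd R 2 4 x 1 * (nth [::] rows 0)`_k + @crd R 2 4 x 2 * (nth [::] rows 1)`_k +
  @crd R 2 4 x 3 * (nth [::] rows 2)`_k + @crd R 2 4 x 4 * (nth [::] rows 3)`_k +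
  @crd R 2 4 x 5 * (nth [::] rows 4)`_k + @crd R 2 4 x 6 * (nth [::] rows 5)`_k.
Proof.
move=> k6; rewrite -[k]/(nat_of_ord (Ordinal k6 : 'I_(2 + 4))) crdS mxE.
transitivity (\sum_(i < 6) @crd R 2 4 x i.+1 * (nth [::] rows i)`_k).
  by apply: eq_bigr => i _; rewrite mxE (@crdS _ 2 4).
rewrite -(big_mkord xpredT (fun i => @crd R 2 4 x i.+1 * (nth [::] rows i)`_k)).
by rewrite unlock /= addr0 !addrA.
Qed.

(** For D = ad e_2, the vector e_4 is cyclic: it goes to e_3, then e_5, then u e_3 - e_6, and D^4
    e_4 = u D^2 e_4 + v e_4. The brackets along e_1 are then dictated by omega (D v, w). *)
Definition g5_deformed_table (u v : R) :=
  [:: entry 2 3 5 1; entry 2 4 3 1; entry 2 5 6 (-1);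
      entry 3 3 1 (-1); entry 4 5 1 1;
      entry 2 5 3 u; entry 5 5 1 u; entry 2 6 4 (- v); entry 6 6 1 (- v)].

Definition g5_deformed (u v : R) := of_table 2 4 (g5_deformed_table u v).

Local Notation X := (@crd R 2 4).

(** A product of types rather than a conjunction, to serve as a rewriting multirule. *)
Lemma crd_g5_deformed u v x y :
  ((X (bracket (g5_deformed u v) x y) 1 =
    (- X x 3 * X y 3 + X x 4 * X y 5 + X x 5 * X y 4 + u * X x 5 * X y 5
    - v * X x 6 * X y 6)%R) *
  (X (bracket (g5_deformed u v) x y) 2 = 0%R) *
  (X (bracket (g5_deformed u v) x y) 3 =
    (X x 2 * X y 4 - X x 4 * X y 2 + u * (X x 2 * X y 5 - X x 5 * X y 2))%R) *
  (X (bracket (g5_deformed u v) x y) 4 = (- v * (X x 2 * X y 6 - X x 6 * X y 2))%R) *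
  (X (bracket (g5_deformed u v) x y) 5 = (X x 2 * X y 3 - X x 3 * X y 2)%R) *
  (X (bracket (g5_deformed u v) x y) 6 = (X x 5 * X y 2 - X x 2 * X y 5)%R))%type.
Proof.
by do ?split; rewrite (@crd_bracket _ 2 4) // unlock /=; ring.
Qed.

Lemma crd_g2 x y :
  ((X (bracket (g2_24 R) x y) 1 = (X x 5 * X y 5 + X x 4 * X y 6 + X x 6 * X y 4)%R) *
  (X (bracket (g2_24 R) x y) 2 = 0%R) *
  (X (bracket (g2_24 R) x y) 3 = (X x 2 * X y 5 - X x 5 * X y 2)%R) *
  (X (bracket (g2_24 R) x y) 4 = (X x 2 * X y 4 - X x 4 * X y 2)%R) *
  (X (bracket (g2_24 R) x y) 5 = 0%R) *
  (X (bracket (g2_24 R) x y) 6 = (X x 6 * X y 2 - X x 2 * X y 6)%R))%type.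
Proof.
by do ?split; rewrite (@crd_bracket _ 2 4) // unlock /=; ring.
Qed.

Lemma crd_g3 l x y :
  ((X (bracket (g3_24 l) x y) 1 = (X x 3 * X y 5 + X x 5 * X y 3
      + l * (X x 4 * X y 6 + X x 6 * X y 4))%R) *
  (X (bracket (g3_24 l) x y) 2 = 0%R) *
  (X (bracket (g3_24 l) x y) 3 = (X x 2 * X y 3 - X x 3 * X y 2)%R) *
  (X (bracket (g3_24 l) x y) 4 = (l * (X x 2 * X y 4 - X x 4 * X y 2))%R) *
  (X (bracket (g3_24 l) x y) 5 = (X x 5 * X y 2 - X x 2 * X y 5)%R) *
  (X (bracket (g3_24 l) x y) 6 = (l * (X x 6 * X y 2 - X x 2 * X y 6))%R))%type.
Proof.
by do ?split; rewrite (@crd_bracket _ 2 4) // unlock /=; ring.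
Qed.

Lemma g5_deformed_super_jacobi u v : super_jacobi (g5_deformed u v).
Proof.
move=> p q x y z hx hy.
by apply: eq_crd24; rewrite crdD crdZ !crd_g5_deformed /koszul; use_parity;
  rewrite ?expr0 ?expr1; ring.
Qed.

Lemma g5_deformed_lie u v : lie_superalgebra (g5_deformed u v).
Proof.
split; first exact: of_table_even.
- exact: of_table_super_skew.
- exact: g5_deformed_super_jacobi.
Qed.

(** A hyperbolic plane on e_1, e_2 plus the symplectic form omega, for which (e_3, e_5) and (e_4,
    e_6) are dual pairs. It is the same for all u and v, since D always lies in the symplectic Lie
    algebra of omega. *)
Definition g5_form : 'M[R]_(2 + 4) := rows_mx
  [:: [:: 0; 1]; [:: 1]; [:: 0; 0; 0; 0; 1]; [:: 0; 0; 0; 0; 0; 1];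
      [:: 0; 0; - 1]; [:: 0; 0; 0; - 1]].

Lemma g5_formE x y : Defs.form g5_form x y =
  X x 1 * X y 2 + X x 2 * X y 1 +
  X x 3 * X y 5 - X x 5 * X y 3 + X x 4 * X y 6 - X x 6 * X y 4.
Proof.
rewrite /Defs.form mxE.
transitivity (\sum_(i < 2 + 4) X (x *m g5_form) i.+1 * X y i.+1).
  by apply: eq_bigr => i _; rewrite !(@crdS _ 2 4) [in RHS]mxE !mxE.
rewrite -(big_mkord xpredT (fun i => X (x *m g5_form) i.+1 * X y i.+1)).
by rewrite unlock /= !crd_rows_mx //=; ring.
Qed.

Lemma g5_deformed_metric u v : metric_lie_superalgebra (g5_deformed u v).
Proof.
split; first exact: g5_deformed_lie.
exists g5_form; split.
- move=> p q x y hx hy; rewrite g5_formE.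
  by use_parity => //= _; ring.
- move=> p q x y hx hy; rewrite !g5_formE /koszul.
  by use_parity; rewrite ?expr0 ?expr1; ring.
- by move=> x y z; rewrite !g5_formE !crd_g5_deformed; ring.
(* The inverse matrix: the hyperbolic block is its own inverse, the symplectic block changes
   sign. *)
- apply: (@nondegenerate_mx _ _ _ _ (rows_mx
    [:: [:: 0; 1]; [:: 1]; [:: 0; 0; 0; 0; - 1]; [:: 0; 0; 0; 0; 0; - 1];
        [:: 0; 0; 1]; [:: 0; 0; 0; 1]])); apply: mulmx_eq1 => x.
  by apply: eq_crd24; rewrite !crd_rows_mx //=; ring.
Qed.

End Deformed.

(** * Explicit isomorphisms *)

Section Isomorphisms24.
Variable K : numFieldType.
Implicit Types c l : K.

(** The rows are the images of e_1, ..., e_6; the second matrix is the inverse. In the target ad e_2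
    has odd eigenvalues c, - c, 0, 0: e_2 is divided by c, e_4 and e_6 go to eigenvectors for c and
    - c, and e_5, e_3 to the nilpotent block. The bracket [e_5, e_5] gives the factor - c^2 on e_1,
    and e_6 is scaled by 1 / (2 c^2) to agree with it. *)
Lemma g2_g5_deformed c : c != 0 ->
  lie_isomorphic (g2_24 K) (g5_deformed (c ^+ 2) 0).
Proof.
move=> c0; apply: (@lie_isomorphic_mx _ _ _ _ _ (rows_mx
  [:: [:: - c ^+ 2]; [:: 0; c^-1]; [:: 0; 0; 0; 0; 0; - c^-1];
      [:: 0; 0; c ^+ 2; 0; c; - 1]; [:: 0; 0; 0; - c ^+ 2; 1];
      [:: 0; 0; 1 / 2; 0; - (2 * c)^-1; - (2 * c ^+ 2)^-1]]) (rows_mx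
  [:: [:: - c ^- 2]; [:: 0; c];
      [:: 0; 0; - c^-1; (2 * c ^+ 2)^-1; 0; 1];
      [:: 0; 0; 0; (2 * c ^+ 3)^-1; - c ^- 2; - c^-1];
      [:: 0; 0; 0; (2 * c)^-1; 0; - c];
      [:: 0; 0; - c]])).
- move=> x; apply: eq_crd24; rewrite !crd_rows_mx //=; field; by rewrite ?c0.
- move=> p x hx; apply/homogeneous24P; rewrite !crd_rows_mx //=; use_parity; split; ring.
- by move=> x y; apply: eq_crd24; rewrite !crd_g5_deformed !crd_rows_mx //= !crd_g2;
    field; by rewrite ?c0.
Qed.

(* In the target, ad e_2 has eigenvalues c, c l, - c, - c l on the odd part, with eigenvectors
   (k^3 - u k) e_4 + k^2 e_3 + k e_5 - e_6 for the eigenvalue k, where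
   u = c^2 (1 + l^2); e_4 is sent to - 1 / l times such a vector to get
   [e_4, e_6] = l e_1. *)
Lemma g3_g5_deformed c l : c != 0 -> l != 0 -> l ^+ 2 != 1 ->
  lie_isomorphic (g3_24 l)
    (g5_deformed (c ^+ 2 * (1 + l ^+ 2)) (- (c ^+ 4 * l ^+ 2))).
Proof.
move=> c0 l0 l1.
have l10 : l ^+ 2 - 1 != 0 by rewrite subr_eq0.
(* [O] is the value of omega both on the images of e_3, e_5 and on those of e_4, e_6. Hence the
   factor c O on e_1, and the denominator O in the inverse matrix, computed from dual bases. *)
pose O := 2 * c ^+ 3 * (l ^+ 2 - 1).
apply: (@lie_isomorphic_mx _ _ _ _ _ (rows_mx
  [:: [:: 2 * c ^+ 4 * (l ^+ 2 - 1)]; [:: 0; c^-1];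
      [:: 0; 0; c ^+ 2; - c ^+ 3 * l ^+ 2; c; - 1];
      [:: 0; 0; - c ^+ 2 * l; c ^+ 3; - c; l^-1];
      [:: 0; 0; c ^+ 2; c ^+ 3 * l ^+ 2; - c; - 1];
      [:: 0; 0; c ^+ 2 * l ^+ 2; c ^+ 3 * l; - c * l; - 1]]) (rows_mx
  [:: [:: (2 * c ^+ 4 * (l ^+ 2 - 1))^-1]; [:: 0; c];
      [:: 0; 0; - c / O; - c * l / O; - c / O; c / O];
      [:: 0; 0; - 1 / O; - 1 / O; 1 / O; - l^-1 / O];
      [:: 0; 0; - c ^+ 2 / O; - c ^+ 2 * l ^+ 2 / O; c ^+ 2 / O; - c ^+ 2 * l / O];
      [:: 0; 0; - c ^+ 3 * l ^+ 2 / O; - c ^+ 3 * l / O; - c ^+ 3 * l ^+ 2 / O;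
          c ^+ 3 / O]])).
- move=> x; apply: eq_crd24; rewrite !crd_rows_mx //= /O; field;
  by rewrite ?l10 ?l0 ?c0.
- move=> p x hx; apply/homogeneous24P; rewrite !crd_rows_mx //=; use_parity; split; ring.
- move=> x y; apply: eq_crd24; rewrite !crd_g5_deformed !crd_rows_mx //= !crd_g3;
    field; by rewrite ?l10 ?l0 ?c0.
Qed.

(** Exchanges the eigenlines for l and - l; the sign in e_6 -> - e_4 makes up for the sign change in
    [e_4, e_6]. *)
Lemma g3_opp l : lie_isomorphic (g3_24 l) (g3_24 (- l)).
Proof.
apply: (@lie_isomorphic_mx _ _ _ _ _ (rows_mx
  [:: [:: 1]; [:: 0; 1]; [:: 0; 0; 1]; [:: 0; 0; 0; 0; 0; 1]; [:: 0; 0; 0; 0; 1];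
      [:: 0; 0; 0; - 1]]) (rows_mx
  [:: [:: 1]; [:: 0; 1]; [:: 0; 0; 1]; [:: 0; 0; 0; 0; 0; - 1]; [:: 0; 0; 0; 0; 1];
      [:: 0; 0; 0; 1]])).
- by move=> x; apply: eq_crd24; rewrite !crd_rows_mx //=; ring.
- move=> p x hx; apply/homogeneous24P; rewrite !crd_rows_mx //=; use_parity; split; ring.
- by move=> x y; apply: eq_crd24; rewrite !crd_g3 !crd_rows_mx //= !crd_g3; ring.
Qed.

(** Multiplying e_2 by l turns the eigenvalues 1, 1/l into l, 1, so the pairs (e_3, e_5) and (e_4,
    e_6) are exchanged; the factor l on e_5, e_6 restores the brackets along e_1. *)
Lemma g3_inv l : l != 0 -> lie_isomorphic (g3_24 l) (g3_24 l^-1).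
Proof.
move=> l0; apply: (@lie_isomorphic_mx _ _ _ _ _ (rows_mx
  [:: [:: 1]; [:: 0; l]; [:: 0; 0; 0; 1]; [:: 0; 0; 1]; [:: 0; 0; 0; 0; 0; l];
      [:: 0; 0; 0; 0; l]]) (rows_mx
  [:: [:: 1]; [:: 0; l^-1]; [:: 0; 0; 0; 1]; [:: 0; 0; 1]; [:: 0; 0; 0; 0; 0; l^-1];
      [:: 0; 0; 0; 0; l^-1]])).
- by move=> x; apply: eq_crd24; rewrite !crd_rows_mx //=; field.
- move=> p x hx; apply/homogeneous24P; rewrite !crd_rows_mx //=; use_parity; split; ring.
- by move=> x y; apply: eq_crd24; rewrite !crd_g3 !crd_rows_mx //= !crd_g3; field.
Qed.

End Isomorphisms24.

(** * Spectra of the adjoint action, and non-isomorphism *)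

Section Eigenvalues.
Variable K : numFieldType.
Implicit Types (x w : 'rV[K]_(2 + 4)) (k l : K).
Local Notation X := (@crd K 2 4).

Definition basis24 (a : nat) : 'rV[K]_(2 + 4) := \row_i (a == i.+1)%:R.

Lemma crd_basis24 a b : (b < 6)%N -> X (basis24 a) b.+1 = (a == b.+1)%:R.
Proof.
by move=> b6; rewrite -[b]/(nat_of_ord (Ordinal b6 : 'I_(2 + 4))) crdS mxE.
Qed.

(** Compares spectra: in the algebras below, ad (f e_2) acts on the odd part through the
    e_2-coordinate of f e_2 alone. *)
Lemma lie_isomorphic_eigenvector (g h : structure_constants K 2 4) a k
    (f : {linear 'rV[K]_(2 + 4) -> 'rV[K]_(2 + 4)}) :
  injective f -> (forall p x, homogeneous p x -> homogeneous p (f x)) ->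
  (forall x y, f (bracket g x y) = bracket h (f x) (f y)) ->
  (2 < a <= 6)%N -> bracket g (basis24 2) (basis24 a) = k *: basis24 a ->
  exists w, [/\ homogeneous true w, w != 0 & bracket h (f (basis24 2)) w = k *: w].
Proof.
move=> f_inj pf mf a26 ga; exists (f (basis24 a)); split.
- apply: pf; apply/homogeneous24P; rewrite !crd_basis24 //.
  by case: a a26 {ga} => [|[|[|a]]].
- rewrite -(raddf0 f) (inj_eq f_inj); apply/eqP => a0.
  case: a a0 a26 {ga} => // a /(congr1 (fun x => X x a.+1)).
  by rewrite crd0 => + /andP[_ a6]; rewrite crd_basis24 // eqxx => /eqP; rewrite oner_eq0.
- by rewrite -mf ga linearZ.
Qed.

Lemma g5_deformed00 : g5_deformed 0 0 =2 g5_24 K.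
Proof.
move=> i j; apply/rowP => k; rewrite !mxE unlock /= !oppr0 !mulr0.
by rewrite !if_same !add0r.
Qed.

(** On the odd part ad x is a multiple of a nilpotent Jordan block, so the coordinates 4, 3, 5, 6 of
    w vanish in turn. *)
Lemma g5_no_eigenvector x w :
  homogeneous true w -> bracket (g5_deformed 0 0) x w = w -> w = 0.
Proof.
move=> /homogeneous24P[w1 w2] xw.
have w4 : X w 4 = 0 by rewrite -xw crd_g5_deformed; ring.
have w6 : X w 6 = - (X x 2 * X w 5) by rewrite -{1}xw crd_g5_deformed w2; ring.
have w5 : X w 5 = X x 2 * X w 3 by rewrite -{1}xw crd_g5_deformed w2; ring.
have w3 : X w 3 = 0 by rewrite -xw crd_g5_deformed w2 w4; ring.
by apply: eq_crd24; rewrite crd0 ?w6 ?w5 ?w4 ?w3 ?w2 ?w1; ring.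
Qed.

(** On the odd part ad x is diagonal with entries s, l s, - s, - l s, where s is the e_2-coordinate
    of x; squares absorb the signs. *)
Lemma g3_eigenvalue l x w k : homogeneous true w -> w != 0 ->
  bracket (g3_24 l) x w = k *: w ->
  k ^+ 2 = X x 2 ^+ 2 \/ k ^+ 2 = l ^+ 2 * X x 2 ^+ 2.
Proof.
move=> /homogeneous24P[w1 w2] w0 xw.
have [|kx] := eqVneq (k ^+ 2) (X x 2 ^+ 2); first by left.
have [|klx] := eqVneq (k ^+ 2) (l ^+ 2 * X x 2 ^+ 2); first by right.
have eig0 r a : r ^+ 2 != k ^+ 2 -> r * X w a = k * X w a -> X w a = 0.
  move=> rk /eqP; rewrite -subr_eq0 -mulrBl mulf_eq0 => /orP[|/eqP //].
  by rewrite subr_eq0 => /eqP rE; rewrite rE eqxx in rk.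
case/eqP: w0; apply: eq_crd24; rewrite crd0 //.
- by apply: (eig0 (X x 2)); [rewrite eq_sym|rewrite -[RHS]crdZ -xw crd_g3 w2; ring].
- apply: (eig0 (l * X x 2)); first by rewrite eq_sym exprMn.
  by rewrite -[RHS]crdZ -xw crd_g3 w2; ring.
- by apply: (eig0 (- X x 2)); [rewrite eq_sym sqrrN|rewrite -[RHS]crdZ -xw crd_g3 w2; ring].
- apply: (eig0 (- (l * X x 2))); first by rewrite eq_sym sqrrN exprMn.
  by rewrite -[RHS]crdZ -xw crd_g3 w2; ring.
Qed.

(** Here s is the square of the ratio of the two spectra, read on the e_2-coordinate of the image of
    e_2. *)
Lemma g3_isomorphism_eigenvalues l m : lie_isomorphic (g3_24 l) (g3_24 m) ->
  exists s, (1 = s \/ 1 = m ^+ 2 * s) /\ (l ^+ 2 = s \/ l ^+ 2 = m ^+ 2 * s).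
Proof.
move=> [f [bf pf mf]].
exists (X (f (basis24 2)) 2 ^+ 2); split.
  have [||w [w1 w0 ew]] := lie_isomorphic_eigenvector (a := 3%N) (k := 1) (bij_inj bf) pf mf.
  - by [].
  - by apply: eq_crd24; rewrite crdZ crd_g3 !crd_basis24 //=; ring.
  - by have := g3_eigenvalue w1 w0 ew; rewrite expr1n.
have [||w [w1 w0 ew]] := lie_isomorphic_eigenvector (a := 4%N) (k := l) (bij_inj bf) pf mf.
- by [].
- by apply: eq_crd24; rewrite crdZ crd_g3 !crd_basis24 //=; ring.
- exact: g3_eigenvalue w1 w0 ew.
Qed.

Lemma g3_isomorphic_param l m : lie_isomorphic (g3_24 l) (g3_24 m) ->
  l ^+ 2 = m ^+ 2 \/ l ^+ 2 * m ^+ 2 = 1.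
Proof.
move=> lm; have [s [s1 sl]] := g3_isomorphism_eigenvalues lm.
(* If 1 and l^2 are matched with the same value, only l^2 = 1 follows; the inverse isomorphism then
   yields m^2 = 1. *)
have [t [t1 tm]] := g3_isomorphism_eigenvalues (lie_isomorphic_sym lm).
move: (l ^+ 2) (m ^+ 2) s1 sl t1 tm => {lm}l {}m; case=> s1; case=> sl.
- rewrite sl -s1 !mul1r => -[<-|<-]; case=> ->; by left.
- by left; rewrite sl -s1 mulr1.
- by right; rewrite sl mulrC -s1.
- rewrite sl -s1 !mul1r => -[<-|<-]; case=> ->; by left.
Qed.

(** The inverse isomorphism would carry e_4, of eigenvalue 1, into an algebra where that eigenvalue
    does not occur. *)
Lemma g5_not_g2 : ~ lie_isomorphic (g5_24 K) (g2_24 K).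
Proof.
move=> /(eq_lie_isomorphic (fun i j => esym (g5_deformed00 i j)))/lie_isomorphic_sym.
move=> [f [bf pf mf]].
have [||w [w1 /eqP w0 ew]] := lie_isomorphic_eigenvector (a := 4%N) (k := 1) (bij_inj bf) pf mf.
- by [].
- by apply: eq_crd24; rewrite crdZ crd_g2 !crd_basis24 //=; ring.
- by apply: w0; apply: (g5_no_eigenvector (x := f (basis24 2)) w1); rewrite ew scale1r.
Qed.

Lemma g5_not_g3 l : ~ lie_isomorphic (g5_24 K) (g3_24 l).
Proof.
move=> /(eq_lie_isomorphic (fun i j => esym (g5_deformed00 i j)))/lie_isomorphic_sym.
move=> [f [bf pf mf]].
have [||w [w1 /eqP w0 ew]] := lie_isomorphic_eigenvector (a := 3%N) (k := 1) (bij_inj bf) pf mf.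
- by [].
- by apply: eq_crd24; rewrite crdZ crd_g3 !crd_basis24 //=; ring.
- by apply: w0; apply: (g5_no_eigenvector (x := f (basis24 2)) w1); rewrite ew scale1r.
Qed.
End Eigenvalues.

(** * Polynomial deformations: specialization, jumps and smoothness *)

Definition poly_fps (K : comNzRingType) (p : {poly K}) : fps K := FPS (nth 0 p).

Lemma poly_fps_is_additive (K : comNzRingType) : additive (@poly_fps K).
Proof. by move=> p q; apply: fpsP => r /=; rewrite coefB. Qed.

HB.instance Definition _ (K : comNzRingType) :=
  GRing.isAdditive.Build {poly K} (fps K) (@poly_fps K) (@poly_fps_is_additive K).

Lemma poly_fps1 (K : comNzRingType) : poly_fps (1 : {poly K}) = 1.
Proof. by apply: fpsP => r /=; rewrite coef1. Qed.

Section PolynomialDeformation.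
Variable K : numFieldType.
Implicit Types (u v p : {poly K}) (a : K).

(** With polynomial parameters, the bracket over K[[t]] and the value at each [a] both come from one
    table over [{poly K}]. *)
Definition poly_deformation u v (r : nat) : structure_constants K 2 4 :=
  of_table 2 4 (map_table (coefp r) (g5_deformed_table u v)).

Lemma formal_poly_deformation u v :
  formal_bracket (poly_deformation u v) = g5_deformed (poly_fps u) (poly_fps v).
Proof.
apply/funext => i; apply/funext => j; apply/rowP => k; rewrite !mxE.
transitivity (poly_fps (of_table 2 4 (g5_deformed_table u v) i j 0 k)).
  by apply: fpsP => r /=; rewrite of_table_map.
rewrite -(of_table_map (@poly_fps K)) mxE.
by rewrite /map_table /= !raddfN /= !poly_fps1.
Qed.

(** The vanishing constant terms make g^5 the term of order 0; the metric comes from the family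
    taken over K[[t]]. *)
Lemma poly_deformation_metric u v : u`_0 = 0 -> v`_0 = 0 ->
  metric_deformation (g5_24 K) (poly_deformation u v).
Proof.
move=> u0 v0; split; last by rewrite formal_poly_deformation; exact: g5_deformed_metric.
split; last by rewrite formal_poly_deformation; exact: g5_deformed_lie.
  move=> i j; rewrite -g5_deformed00 /poly_deformation /g5_deformed; congr (of_table _ _ _ i j).
  by rewrite /map_table /= !coefN !coef1 u0 v0.
by move=> r _; split; [exact: of_table_even|exact: of_table_super_skew].
Qed.

Lemma horner_continuous p : continuous (horner p).
Proof.
elim/poly_ind: p => [|p c p_cont] a.
  by rewrite (_ : horner 0 = cst 0); [exact: cst_continuous |apply/funext => b; rewrite horner0].
rewrite (_ : horner _ = ((horner p : K -> K) \* id) + cst c).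
  apply: (@continuousD K K K); last exact: cst_continuous.
  by apply: (@continuousM K K); [exact: p_cont|exact: cvg_id].
by apply/funext => b; rewrite !hornerE.
Qed.

Lemma horner_cvg_dnbhs p : p.[a] @[a --> 0^'] --> p.[0].
Proof. by apply: cvg_within_filter; exact: horner_continuous. Qed.

Lemma horner_near_neq0 p : p.[0] != 0 -> \forall a \near 0^', p.[a] != 0.
Proof.
move=> p0; refine (cvgr_neq0 (p.[0] : K) _ p0); exact (@horner_cvg_dnbhs p).
Qed.

(** The partial sums are constant from [size p] on. *)
Lemma cvg_poly_series p a : series (fun r => p`_r * a ^+ r) @ \oo --> p.[a].
Proof.
apply: cvg_near_cst; near=> r; rewrite /series /= big_mkord -horner_coef_wide //.
by near: r; exact: nbhs_infty_ge.
Unshelve. all: by end_near. Qed.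

Lemma poly_deformation_specializes u v a :
  specializes (poly_deformation u v) a (g5_deformed u.[a] v.[a]).
Proof.
move=> i j k.
have -> : g5_deformed u.[a] v.[a] i j 0 k = (g5_deformed u v i j 0 k).[a].
  rewrite -[RHS]/(horner_eval a _) -of_table_map; congr (of_table _ _ _ i j 0 k).
  by rewrite /map_table /= /horner_eval !hornerE.
rewrite (_ : (fun r => _) = fun r => (g5_deformed u v i j 0 k)`_r * a ^+ r).
  exact: cvg_poly_series.
by apply/funext => r; rewrite of_table_map.
Qed.

Lemma specializes_unique phi a (g h : structure_constants K 2 4) :
  specializes phi a g -> specializes phi a h -> g =2 h.
Proof.
move=> pg ph i j; apply/rowP => k.
exact: (cvg_unique _ (pg i j k) (ph i j k)).
Qed.

(** The characteristic polynomial becomes (X^2 - t^2) (X^2 - t^2 L^2), with roots t, - t, t L, - t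
    L: up to scaling, the spectrum of g^3(L). *)
Definition spectral_deformation (L : {poly K}) :=
  poly_deformation ('X^2 * (1 + L ^+ 2)) (- ('X^4 * L ^+ 2)).

Lemma spectral_deformation_metric L :
  metric_deformation (g5_24 K) (spectral_deformation L).
Proof. by apply: poly_deformation_metric; rewrite ?coefN coefXnM ?oppr0. Qed.

Lemma spectral_deformation_specializes L a : a != 0 -> L.[a] != 0 -> L.[a] ^+ 2 != 1 ->
  exists2 g, specializes (spectral_deformation L) a g & lie_isomorphic g (g3_24 L.[a]).
Proof.
move=> a0 La La1; eexists; first exact: poly_deformation_specializes.
apply: lie_isomorphic_sym; have := g3_g5_deformed a0 La La1.
by congr (lie_isomorphic _ (g5_deformed _ _)); rewrite !hornerE; ring.
Qed.

(** The Klein four-group generated by negation and inversion. *)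
Definition g3_symmetries : set (K -> K) :=
  [set id; -%R; GRing.inv; fun l => - l^-1].

Lemma g3_symmetriesP :
  g3_symmetries `<=` family_symmetry [set l : K | l != 0] (@g3_24 K).
Proof.
(* All four maps are involutions, so bijectivity reduces to preserving non-zero scalars. *)
have invol (s : K -> K) : involutive s -> (forall l, l != 0 -> s l != 0) ->
    (forall l, l != 0 -> {for l, continuous s}) ->
    (forall l, l != 0 -> lie_isomorphic (g3_24 l) (g3_24 (s l))) ->
    family_symmetry [set l : K | l != 0] (@g3_24 K) s.
  move=> sK s0 s_cont s_iso; split=> //.
    split; [exact: s0|by move=> l m _ _ /(can_inj sK)|].
    by move=> l l0; exists (s l); [exact: s0|exact: sK].
  apply: continuous_in_subspaceT => l /set_mem; exact: s_cont.
have opp_cont : continuous (-%R : K -> K) by exact: opp_continuous.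
have opp0 (l : K) : l != 0 -> - l != 0 by rewrite oppr_eq0.
have inv0 (l : K) : l != 0 -> l^-1 != 0 by rewrite invr_eq0.
have oppinv_cont (l : K) : l != 0 -> {for l, continuous (fun l : K => - l^-1)}.
  by move=> l0; apply: continuous_comp; [exact: inv_continuous|exact: opp_cont].
move=> s [[[->|->]|->]|->]; apply: invol => //.
- by move=> l _; exact: cvg_id.
- by move=> l _; exact: lie_isomorphic_refl.
- exact: opprK.
- by move=> l _; exact: opp_cont.
- by move=> l _; exact: g3_opp.
- exact: invrK.
- by move=> l; exact: inv_continuous.
- exact: g3_inv.
- by move=> l; rewrite invrN opprK invrK.
- by move=> l /inv0/opp0.
- by move=> l l0; apply: lie_isomorphic_trans (g3_inv l0) (g3_opp _).
Qed.

Lemma g3_isomorphic_symmetry l m : l != 0 -> m != 0 ->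
  lie_isomorphic (g3_24 l) (g3_24 m) -> exists2 s, g3_symmetries s & m = s l.
Proof.
move=> l0 m0 /g3_isomorphic_param[/eqP|lm1].
  rewrite eq_sym eqf_sqr => /orP[|] /eqP ->; first by exists id => //; do 3 left.
  by exists -%R => //; left; left; right.
have /eqP : m ^+ 2 = l^-1 ^+ 2.
  by rewrite exprVn; apply: (mulfI (expf_neq0 2 l0)); rewrite lm1 divff ?expf_neq0.
rewrite eqf_sqr => /orP[|] /eqP ->; first by exists GRing.inv => //; left; right.
by exists (fun l => - l^-1) => //; right.
Qed.

Lemma spectral_deformation_smooth L : L.[0] != 0 -> L.[0] ^+ 2 != 1 ->
  injective (horner L) ->
  smooth_deformation_around (g5_24 K) (spectral_deformation L)
    [set l | l != 0] (@g3_24 K) L.[0].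
Proof.
move=> L0 L1 L_inj.
have L_near : \forall a \near 0^', [/\ a != 0, L.[a] != 0 & L.[a] ^+ 2 != 1].
  have hornerL1 a : (L ^+ 2 - 1).[a] = L.[a] ^+ 2 - 1 by rewrite !hornerE.
  near=> a; split; first by near: a; exact: nbhs_dnbhs_neq.
    by near: a; exact: horner_near_neq0.
  (* The condition is rewritten as the non-vanishing of the polynomial L^2 - 1, which persists near
     0. *)
  rewrite -subr_eq0 -hornerL1; near: a.
  by apply: horner_near_neq0; rewrite hornerL1 subr_eq0.
exists (horner L), g3_symmetries; split; last exact: horner_cvg_dnbhs.
- split; last exact: g3_symmetriesP.
  by rewrite /g3_symmetries !finite_setU; do ?split; exact: finite_set1.
- split; first by have [] := spectral_deformation_metric L.
  pose generic := [set a | [/\ a != 0, L.[a] != 0 & L.[a] ^+ 2 != 1]].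
  exists (generic, generic); first by split.
  move=> [a b] /= [[a0 La La1] [b0 Lb Lb1]] ab ga gb pa pb gab.
  split; first by apply: contra_neq ab => /L_inj.
  apply: g3_isomorphic_symmetry => //.
  (* By uniqueness of limits, the arbitrary values [ga], [gb] are the explicit ones, isomorphic to
     g^3(L(a)) and g^3(L(b)). *)
  have [ga' pa' ga3] := spectral_deformation_specializes a0 La La1.
  have [gb' pb' gb3] := spectral_deformation_specializes b0 Lb Lb1.
  apply: lie_isomorphic_trans gb3; apply: lie_isomorphic_trans (lie_isomorphic_sym ga3) _.
  apply: eq_lie_isomorphic (specializes_unique pa pa') _.
  apply: lie_isomorphic_sym; apply: eq_lie_isomorphic (specializes_unique pb pb') _.
  exact: lie_isomorphic_sym.
- apply: filterS L_near => a [a0 La La1]; split=> //.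
  exact: spectral_deformation_specializes.
Unshelve. all: by end_near. Qed.

Lemma jump_deformation_g2 :
  jump_deformation (g5_24 K) (poly_deformation 'X^2 0) (g2_24 K).
Proof.
split; [|exact: g5_not_g2|].
  by case: (@poly_deformation_metric 'X^2 0) => //; rewrite ?coef0 ?coefXn.
near=> a; eexists; first exact: poly_deformation_specializes.
rewrite hornerXn horner0; apply: lie_isomorphic_sym; apply: g2_g5_deformed.
by near: a; exact: nbhs_dnbhs_neq.
Unshelve. all: by end_near. Qed.

(** With L constant, only the scale of the spectrum depends on t. *)
Lemma jump_deformation_g3 l : l != 0 -> l ^+ 2 != 1 ->
  jump_deformation (g5_24 K) (spectral_deformation l%:P) (g3_24 l).
Proof.
move=> l0 l1; split; [|exact: g5_not_g3|].
  by case: (spectral_deformation_metric l%:P).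
near=> a; rewrite -{2}(hornerC l a).
apply: spectral_deformation_specializes; rewrite ?hornerC //.
by near: a; exact: nbhs_dnbhs_neq.
Unshelve. all: by end_near. Qed.
End PolynomialDeformation.

Theorem theorem3p4p5 (R : realType) :
  [/\ exists phi, metric_deformation (g5_24 R[i]) phi /\
        jump_deformation (g5_24 R[i]) phi (g2_24 R[i]),
      exists phi, metric_deformation (g5_24 R[i]) phi /\
        jump_deformation (g5_24 R[i]) phi (g3_24 ('i : R[i]))
    & exists phi, metric_deformation (g5_24 R[i]) phi /\
        smooth_deformation_around (g5_24 R[i]) phi
          [set l : R[i] | l != 0] (@g3_24 R[i]) 'i].
Proof.
have i1 : ('i : R[i]) ^+ 2 != 1 by rewrite sqrCi eqNr oner_eq0.
split.
- exists (poly_deformation 'X^2 0); split; last exact: jump_deformation_g2.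
  by apply: poly_deformation_metric; rewrite ?coef0 ?coefXn.
- exists (spectral_deformation 'i%:P); split; first exact: spectral_deformation_metric.
  by apply: jump_deformation_g3; rewrite ?neq0Ci.
(* The parameter l = i + t is injective in t. As l -> - 1/l fixes i, it relates distinct parameters
   arbitrarily close to i: such coincidences are those allowed by symmetry. *)
- exists (spectral_deformation ('i%:P + 'X)); split; first exact: spectral_deformation_metric.
  have L0 : ('i%:P + 'X : {poly R[i]}).[0] = 'i by rewrite !hornerE.
  have := @spectral_deformation_smooth R[i] ('i%:P + 'X); rewrite L0; apply=> //.
    exact: neq0Ci.
  by move=> a b; rewrite !hornerE => /addrI.
Qed.
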